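(* There exists a real $\alpha\in(0,1)$ such that for every pair of computable reals $r,t>1$ and every integer $c\ge1$ there exists an integer $b\ge1$ such that for every $m\ge1$, \[H_U(\alpha[m])\ge \frac{1}{r}\, m+\frac{c}{t}\log_2 m-b.\]
   Context: Binary strings over $\Sigma=\{0,1\}$. $U$ is a fixed universal self-delimiting Turing machine: a Turing machine on binary strings with prefix-free domain such that for every self-delimiting machine $C$ there is $c\ge0$ with, for every $x\in\mathrm{dom}(C)$, some $p_x\in\mathrm{dom}(U)$ with $|p_x|\le|x|+c$ and $U(p_x)=C(x)$. $H_U(x)=\min\{|w|:U(w)=x\}$. For $\alpha\in(0,1)$, $\alpha[m]$ is the first $m$ bits of its unending binary expansion. *)

(* Defs.v *)
From HB Require Import structures.
From mathcomp Require Import all_boot all_order all_algebra.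
From mathcomp Require Import all_classical all_reals all_analysis.
Set Implicit Arguments.
Unset Strict Implicit.
Unset Printing Implicit Defensive.
Import Order.TTheory GRing.Theory Num.Theory.
Import numFieldNormedType.Exports.
Local Open Scope classical_set_scope.
Local Open Scope ring_scope.

Notation bitstring := (seq bool).

Inductive direction := MoveLeft | Stay | MoveRight.

(* A tape symbol is a bit [Some (inl b)], a work symbol [Some (inr k)],
   or the blank [None]. *)
Definition symbol (work : finType) := option (bool + work)%type.

(* Deterministic one-tape Turing machines; the machine halts when the
   transition function is undefined. *)
Record machine := Machine {
  state : finType;
  work : finType;
  start : state;
  step : state -> symbol work -> option (state * symbol work * direction)
}.

(* A two-way infinite tape: [left_cells] lists the cells to the left of the
   head, nearest first; [right_cells] starts with the scanned cell.  All cells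
   beyond either list are blank. *)
Record config (M : machine) := Config {
  current : state M;
  left_cells : seq (symbol (work M));
  right_cells : seq (symbol (work M))
}.

Definition scanned M (c : config M) : symbol (work M) :=
  head None (right_cells c).

Definition next_action M (c : config M) := step (current c) (scanned c).

Definition halted M (c : config M) : bool := ~~ isSome (next_action c).

Definition next_config M (c : config M) : config M :=
  match next_action c with
  | None => c
  | Some (q, s, d) =>
    let l := left_cells c in
    let r := s :: behead (right_cells c) in
    match d with
    | MoveLeft => Config q (behead l) (head None l :: r)
    | Stay => Config q l r
    | MoveRight => Config q (s :: l) (behead r)
    end
  end.

Definition initial M (w : bitstring) : config M :=
  Config (start M) [::] [seq Some (inl b) | b <- w].

Fixpoint leading_bits (K : finType) (s : seq (symbol K)) : bitstring :=
  if s is Some (inl b) :: s' then b :: leading_bits s' else [::].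

(* The output is the maximal block of bits starting at the halting position of
   the head. *)
Definition output M (c : config M) : bitstring := leading_bits (right_cells c).

(* [evaluates M w y] is M(w) = y, for the partial function computed by M. *)
Definition evaluates (M : machine) (w y : bitstring) : Prop :=
  exists n, let c := iter n (@next_config M) (initial M w) in
            halted c /\ output c = y.

Definition dom (M : machine) : set bitstring :=
  [set w | exists y, evaluates M w y].

Definition self_delimiting (M : machine) : Prop :=
  forall w w', dom M w -> dom M w' -> prefix w w' -> w = w'.

Definition universal (U : machine) : Prop :=
  self_delimiting U /\
  forall C : machine, self_delimiting C ->
    exists c : nat, forall x y, evaluates C x y ->
      exists p, (size p <= size x + c)%N /\ evaluates U p y.

Definition is_min_program_size (M : machine) (x : bitstring) (h : nat) : Prop :=
  (exists2 w, evaluates M w x & size w = h) /\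
  (forall w, evaluates M w x -> (h <= size w)%N).

(* H_M(x).  The default value 0 is only taken at strings outside the range of
   M; a universal machine has every string in its range. *)
Definition H (M : machine) (x : bitstring) : nat :=
  xget 0%N [set h | is_min_program_size M x h].

(* [a i] is the digit of weight 2^-(i+1).  "Unending" means infinitely many
   digits 1, so that dyadic rationals get the expansion ending in 111... *)
Definition unending_expansion (R : realType) (alpha : R) (a : nat -> bool) :
    Prop :=
  (series (fun i : nat => (a i)%:R / 2 ^+ i.+1 : R) @ \oo --> alpha) /\
  (forall n : nat, exists2 k, (n <= k)%N & a k).

(* Every alpha in ]0, 1] has exactly one unending expansion, so the default
   digit sequence is irrelevant for alpha in ]0, 1[. *)
Definition digits (R : realType) (alpha : R) : nat -> bool :=
  xget (fun=> false) [set a | unending_expansion alpha a].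

Definition first_bits (R : realType) (alpha : R) (m : nat) : bitstring :=
  mkseq (digits alpha) m.

(* Natural numbers are given to machines in unary. *)
Definition computable_nat_fun (f : nat -> nat) : Prop :=
  exists M : machine,
    forall n, evaluates M (nseq n true) (nseq (f n) true).

(* A real is computable if it is the limit, with error at most 2^-n, of a
   computable sequence of rationals (-1)^(s n) * p n / q n. *)
Definition computable_real (R : realType) (x : R) : Prop :=
  exists s p q : nat -> nat,
    [/\ computable_nat_fun s, computable_nat_fun p, computable_nat_fun q,
        (forall n, (0 < q n)%N) &
        forall n, `| (-1) ^+ s n * (p n)%:R / (q n)%:R - x | <= 2 ^- n].

Definition log2 (R : realType) (x : R) : R := ln x / ln 2.

(* Main.v *)
(* Take alpha to be a Martin-Loef random real: some constant k satisfies
   H(alpha[m]) >= m - k for all m.  Since 1/r < 1, the linear term m - m/r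
   absorbs (c/t) log2 m up to a constant.  Such an alpha exists by counting: a
   string with a prefix that has a shorter program can be re-encoded one bit
   shorter, so at most half of the strings of each length have such a prefix,
   and Koenig's lemma gives an infinite sequence without one. *)
Require Import Defs.
From mathcomp Require Import all_boot all_order all_algebra.
From mathcomp Require Import all_classical all_reals all_analysis.
From mathcomp Require Import zify lra ring.
Import Order.TTheory GRing.Theory Num.Theory.
Import numFieldNormedType.Exports.
Local Open Scope ring_scope.

(** * Runs of machines and shortest programs *)

Lemma iter_halted M (c : config M) n : halted c -> iter n (@next_config M) c = c.
Proof.
move=> hc; elim: n => //= n ->; rewrite /next_config.
by move: hc; rewrite /halted; case: next_action.
Qed.

Lemma evaluates_inj M w y y' : evaluates M w y -> evaluates M w y' -> y = y'.
Proof.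
move=> [n [hn <-]] [n' [hn' <-]].
wlog le_nn' : n n' hn hn' / (n <= n')%N.
  move=> Hw; have [le|/ltnW le] := leqP n n'; first exact: Hw.
  by apply/esym; exact: Hw.
by rewrite -(subnK le_nn') iterD [in RHS]iter_halted.
Qed.

(* On the empty input, writes x from right to left; loops on any other input.
   It puts x in the range of U, where H U x is not the junk value 0. *)
Definition writer (x : bitstring) : machine :=
  @Machine 'I_(size x).+2 void ord0 (fun q a =>
    if (q <= size x)%N then
      if a is Some _ then Some (q, a, Stay)
      else if (q < size x)%N then
        Some (inord q.+1, Some (inl (nth false x (size x - q.+1))), MoveLeft)
      else Some (inord q.+1, None, MoveRight)
    else None).

(** Invariant: the head scans a blank, with the last k bits of x to its right. The tape list is
    still empty at k = 0, hence the use of [head] and [behead]. *)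
Lemma writer_run x k : (k <= size x)%N ->
  exists2 r, iter k (@next_config (writer x)) (initial (writer x) [::]) =
               @Config (writer x) (inord k) [::] r &
    head None r = None /\
    behead r = [seq Some (inl b) | b <- drop (size x - k) x].
Proof.
elim: k => [_|k IHk ltk].
  exists [::]; last by rewrite subn0 drop_size.
  by congr Config; apply: val_inj; rewrite /= inordK.
have [r /= -> [hr br]] := IHk (ltnW ltk).
exists [:: None, Some (inl (nth false x (size x - k.+1))) & behead r].
  rewrite /next_config /next_action /scanned /= hr.
  by rewrite inordK ?ltnS ?(ltnW ltk) ?leqW ?(ltnW ltk)// ltk.
split=> //=; rewrite br [in RHS](drop_nth false) /=; last by lia.
by congr (_ :: map _ (drop _ _)); lia.
Qed.

Lemma writer_evaluates x : evaluates (writer x) [::] x.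
Proof.
exists (size x).+1; have [r /= -> [hr br]] := writer_run x _ (leqnn _).
rewrite /next_config /next_action /scanned /= hr inordK// leqnn ltnn br subnn drop0.
rewrite /halted /next_action /= inordK// ltnn; split=> //.
by rewrite /output /=; elim: x {r hr br} => //= b x ->.
Qed.

(** A bit under the head makes the first step a loop, so every nonempty input diverges; this makes
    the writer self-delimiting. *)
Lemma writer_dom x w : Defs.dom (writer x) w -> w = [::].
Proof.
case: w => // b w [y [n []]].
have step0 : next_config (initial (writer x) (b :: w)) =
    initial (writer x) (b :: w) by [].
by rewrite iter_fix.
Qed.

Lemma universal_total U x : universal U -> exists w, evaluates U w x.
Proof.
move=> [_ univ].
have [|c /(_ _ _ (writer_evaluates x)) [p [_ Up]]] := univ (writer x).
  by move=> w w' /writer_dom -> /writer_dom ->.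
by exists p.
Qed.

Lemma H_program U x : universal U -> exists2 w, evaluates U w x & size w = H U x.
Proof.
move=> hU; have [w0 Uw0] := universal_total _ x hU.
pose P n := `[< exists2 w, evaluates U w x & size w = n >].
have exP : exists n, P n by exists (size w0); apply/asboolP; exists w0.
case: (ex_minnP exP) => h /asboolP hw minh.
have : is_min_program_size U x (H U x).
  apply: (@xgetPex _ 0%N [set h | is_min_program_size U x h]%classic).
  exists h; split=> // w Uw.
  by apply: minh; apply/asboolP; exists w.
by case.
Qed.

(** * Incompressible sequences for prefix codes *)

Lemma prefix_comparable (T : eqType) (u v s : seq T) :
  prefix u s -> prefix v s -> prefix u v || prefix v u.
Proof.
wlog le_uv : u v / (size u <= size v)%N.
  move=> Hw us vs; have [le|/ltnW le] := leqP (size u) (size v); first exact: Hw.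
  by rewrite orbC; exact: Hw.
rewrite !prefixE => /eqP us /eqP vs; apply/orP; left.
by rewrite -[X in take _ X]vs take_takel// us.
Qed.

Definition prefix_code (E : bitstring -> bitstring -> Prop) : Prop :=
  forall p x p' x', E p x -> E p' x' -> prefix p p' -> p = p' /\ x = x'.

Definition compressible (E : bitstring -> bitstring -> Prop) x : Prop :=
  exists2 p, E p x & (size p < size x)%N.

(* Otherwise, replacing a compressible prefix of each string of length n by its
   code, and padding, maps these strings injectively to strings of length
   n - 1: the code, hence the length of the original prefix, can be read off
   the image. *)
Lemma incompressible_string E n : prefix_code E ->
  exists2 s, size s = n & forall m, ~ compressible E (take m s).
Proof.
move=> codeE; apply: contrapT => noS.
have shorten (t : n.-tuple bool) : exists px : bitstring * bitstring,
    [/\ E px.1 px.2, prefix px.2 t & (size px.1 < size px.2)%N].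
  apply: contrapT => not_t; apply: noS; exists t; first exact: size_tuple.
  move=> m [p Ep ltp]; apply: not_t; exists (p, take m t).
  by split=> //; exact: prefix_take.
have [f fP] := choice shorten.
(* The padding restores all but one of the bits saved, so the image has n - 1 bits. *)
pose g t := (f t).1 ++ drop (size (f t).2) t ++
  nseq (size (f t).2 - size (f t).1).-1 false.
have size_g t : size (g t) == n.-1.
  have [_ /size_prefix] := fP t; rewrite /=.
  by rewrite !size_cat size_drop size_nseq !size_tuple => ? ?; apply/eqP; lia.
have g_inj : injective (fun t => Tuple (size_g t)).
  move=> t t' /(congr1 val) /= gg.
  have [Et tx _] := fP t; have [Et' tx' _] := fP t'.
  have [] : (f t).1 = (f t').1 /\ (f t).2 = (f t').2.
    have /orP[le|le] : prefix (f t).1 (f t').1 || prefix (f t').1 (f t).1.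
    - by apply: (@prefix_comparable _ _ _ (g t)); [|rewrite gg]; exact: prefix_prefix.
    - exact: codeE le.
    - by have [-> ->] := codeE _ _ _ _ Et' Et le.
  move=> pp xx; apply: val_inj => /=.
  move: tx tx' gg; rewrite /g pp xx => /prefixP[y ->] /prefixP[y' ->].
  rewrite !drop_size_cat// => /eqP; rewrite eqseq_cat// eqxx /= => /eqP.
  (* Reversal brings the equal paddings to the front, where they cancel. *)
  by move=> /(congr1 rev); rewrite !rev_cat => /eqP; rewrite eqseq_cat// eqxx /= => /eqP
    /(congr1 rev); rewrite !revK => ->.
have := leq_card _ g_inj; rewrite !card_tuple card_bool leq_exp2l//.
(* Counting leaves only n = 0, where no prefix can be longer than its code. *)
have [t] : exists t : n.-tuple bool, True by exists (nseq_tuple n false).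
move=> _; have [_ /size_prefix] := fP t; rewrite /=.
by rewrite !size_tuple => ? ? ?; lia.
Qed.

Definition extendable E s : Prop :=
  forall n, exists2 u, size u = n & forall m, ~ compressible E (take m (s ++ u)).

(** Koenig step: if both children of s failed at finite depths, an incompressible extension of s
    reaching past both depths would run through one of them. *)
Lemma extendable_rcons E s : extendable E s -> exists b, extendable E (rcons s b).
Proof.
move=> exts; apply: contrapT => none.
have blocked b : exists n, forall u, size u = n ->
    exists m, compressible E (take m (rcons s b ++ u)).
  apply: contrapT => nob; apply: none; exists b => n.
  apply: contrapT => nou; apply: nob; exists n => u szu.
  by apply: contrapT => nom; apply: nou; exists u => // m cm; apply: nom; exists m.
have [nf nfP] := blocked false; have [nt ntP] := blocked true.
have [[|b u] //= [szu] uP] := exts (maxn nf nt).+1.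
pose n := if b then nt else nf.
have [m cm] : exists m, compressible E (take m (rcons s b ++ take n u)).
  by case: b @n {uP} => n; [apply: ntP|apply: nfP]; rewrite size_takel// szu leq_max leqnn ?orbT.
(* Prefixes of the truncated string are prefixes of the full one, of this length. *)
apply: (uP (minn m (size s + n.+1))); move: cm.
rewrite cat_rcons; congr compressible.
suff -> : s ++ b :: take n u = take (size s + n.+1) (s ++ b :: u).
  by rewrite -take_min.
by rewrite takeD take_size_cat// drop_size_cat.
Qed.

Lemma incompressible_sequence E : prefix_code E ->
  exists a : nat -> bool, forall n, ~ compressible E (mkseq a n).
Proof.
move=> codeE.
have ext0 : extendable E [::] by move=> n; exact: incompressible_string.
(* The implication sits under the quantifier so that [choice] yields a total function; its value at
   a non-extendable s is arbitrary. *)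
have step s : exists b, extendable E s -> extendable E (rcons s b).
  have [/extendable_rcons[b eb]|ne] := pselect (extendable E s); first by exists b.
  by exists false.
have [next nextP] := choice step.
pose s n := iter n (fun s => rcons s (next s)) [::].
exists (fun n => next (s n)) => n.
have -> : mkseq (fun n => next (s n)) n = s n.
  by elim: n => // n IHn; rewrite mkseqS IHn.
have : extendable E (s n) by elim: n => //= n; exact: nextP.
by move=> /(_ 0%N)[u /size0nil-> /(_ n)]; rewrite cats0 take_oversize//; elim: n => //= n; rewrite size_rcons.
Qed.

(** * A prefix code containing the programs of U *)

(* Besides the programs of U, short codes for blocks of zeros and for 111,
   which forbid an incompressible sequence to be ultimately 0 or constantly 1. *)
Definition augmented (U : machine) (p x : bitstring) : Prop :=
  match p with
  | false :: w => evaluates U w x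
  | [:: true; true] => x = nseq 3 true
  | [:: true, false & q] => exists2 s, q = nseq (size s) true ++ false :: s
                                     & x = s ++ nseq (size s + 4) false
  | _ => False
  end.

Lemma prefix_unary (k k' : nat) (s s' : bitstring) :
  prefix (nseq k true ++ false :: s) (nseq k' true ++ false :: s') -> k = k'.
Proof.
elim: k k' => [|k IHk] [|k'] //=.
by move=> /IHk ->.
Qed.

(** The tags 0, 11 and 10 are pairwise incomparable, so only codes of one kind compete; under 10 the
    unary header gives the length of s, hence s. *)
Lemma augmented_prefix_code U : self_delimiting U -> prefix_code (augmented U).
Proof.
move=> sdU [|[] p] x [|[] p'] x' //=; last first.
  move=> Up Up' pp'; have eqp : p = p'.
    by apply: sdU pp'; [exists x|exists x'].
  by rewrite eqp in Up *; rewrite (evaluates_inj _ _ _ _ Up Up').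
case: p => // -[] p; case: p' => // -[] p' //=.
  by case: p p' => // -[] //= -> ->.
move=> [s -> ->] [s' -> ->] pp'.
have eqs := prefix_unary _ _ _ _ pp'.
suff -> : s = s' by [].
by move: pp'; rewrite eqs prefix_catr// eqxx /= prefixE eqs take_size => /eqP ->.
Qed.

(** * Unending binary expansions *)

Section Expansion.
Variable R : realType.
Implicit Types (alpha : R) (a : nat -> bool).

Local Notation partial a := (series (fun i : nat => (a i)%:R / 2 ^+ i.+1 : R)).

Lemma partialS a n : partial a n.+1 = partial a n + (a n)%:R / 2 ^+ n.+1.
Proof. by rewrite !seriesEnat /= big_nat_recr. Qed.

Lemma partial_mono a m n : (m <= n)%N -> partial a m <= partial a n.
Proof.
move=> /subnK <-; elim: (n - m)%N => // k IHk.
by rewrite addSn partialS (le_trans IHk)// lerDl divr_ge0// exprn_ge0.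
Qed.

(** The right ends of the nested dyadic intervals never increase, since a digit adds at most half of
    the current width. *)
Lemma partial_gap a m n : (m <= n)%N ->
  partial a n + 2 ^- n <= partial a m + 2 ^- m.
Proof.
move=> /subnK <-; elim: (n - m)%N => // k IHk.
rewrite addSn partialS (le_trans _ IHk)// -addrA lerD2l.
have h : 2 ^- (k + m) = 2 ^- (k + m).+1 + 2 ^- (k + m).+1 :> R.
  by rewrite exprS invfM; field.
rewrite h lerD2r ler_piMl ?invr_ge0 ?exprn_ge0//.
by case: (a _).
Qed.

Lemma partial_cvg a : cvgn (partial a).
Proof.
apply: nondecreasing_is_cvgn; first by move=> m n; exact: partial_mono.
exists 1 => _ [n _ <-].
have := @partial_gap a 0 n (leq0n n).
rewrite {2}/series /= big_geq// add0r expr0 invr1; apply: le_trans.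
by rewrite lerDl invr_ge0 exprn_ge0.
Qed.

Lemma partial_lt alpha a n : unending_expansion alpha a -> partial a n < alpha.
Proof.
move=> [cva ua]; have [k lek ak] := ua n.
apply: (@lt_le_trans _ _ (partial a k.+1)).
  by rewrite partialS ak (le_lt_trans (partial_mono a _ _ lek))// ltrDl divr_gt0// exprn_gt0.
have cv : cvgn (partial a) by apply/cvg_ex; exists alpha.
rewrite -(cvg_lim _ cva)//.
by apply: nondecreasing_cvgn_le => // m m'; exact: partial_mono.
Qed.

Lemma le_partial alpha a n :
  unending_expansion alpha a -> alpha <= partial a n + 2 ^- n.
Proof.
move=> [cva _].
have cv : cvgn (partial a) by apply/cvg_ex; exists alpha.
rewrite -(cvg_lim _ cva)//; apply: limr_le => //; near=> m.
apply: (@le_trans _ _ (partial a m + 2 ^- m)); first by rewrite lerDl invr_ge0 exprn_ge0.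
by apply: partial_gap; near: m; exact: nbhs_infty_ge.
Unshelve. all: by end_near.
Qed.

(** At the first difference i, with common partial sum S, the digit 1 forces alpha strictly above S
    + 2^-(i+1), the digit 0 at most there. *)
Lemma unending_expansion_inj alpha a a' :
  unending_expansion alpha a -> unending_expansion alpha a' -> a = a'.
Proof.
move=> ha ha'; apply: contrapT => neq.
have diff : exists i, a i != a' i.
  apply: contrapT => nex; apply: neq; apply/funext => i.
  by apply/eqP/negPn/negP => ne; apply: nex; exists i.
case: (ex_minnP diff) => i nei min_i.
wlog [ai ai'] : a a' ha ha' nei min_i {neq diff} / a i = true /\ a' i = false.
  move=> Hw; case ai: (a i); case ai': (a' i).
  - by rewrite ai ai' in nei.
  - exact: (Hw a a').
  - by apply: (Hw a' a) => //; rewrite 1?eq_sym// => k; rewrite eq_sym; exact: min_i.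
  - by rewrite ai ai' in nei.
have eq_partial : partial a i = partial a' i.
  rewrite /series /=; apply: eq_big_nat => k /andP[_ lt_ki].
  suff -> : a k = a' k by [].
  by apply/eqP; apply: contraTT lt_ki => /min_i; rewrite -leqNgt.
have := partial_lt _ _ i.+1 ha; have := le_partial _ _ i.+1 ha'.
rewrite !partialS ai ai' eq_partial mul0r addr0 mul1r => le lt.
by have := lt_le_trans lt le; rewrite ltxx.
Qed.

Lemma digitsE alpha a : unending_expansion alpha a -> digits alpha = a.
Proof.
move=> ha; apply: (unending_expansion_inj _ _ _ _ ha).
by apply: (@xgetPex _ _ [set a | unending_expansion alpha a]%classic); exists a.
Qed.

Lemma expansion_in01 alpha a i :
  unending_expansion alpha a -> a i = false -> 0 < alpha < 1.
Proof.
move=> ha ai.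
have partial0 : partial a 0 = 0 by rewrite /series /= big_geq.
apply/andP; split; first by rewrite -partial0; exact: partial_lt.
apply: (le_lt_trans (le_partial _ _ i.+1 ha)).
rewrite partialS ai mul0r addr0.
apply: (@lt_le_trans _ _ (partial a i + 2 ^- i)).
  by rewrite ltrD2l ltf_pV2 ?posrE ?exprn_gt0// ltr_eXn2l// ltr1n.
by have := @partial_gap a 0 i (leq0n i); rewrite partial0 add0r expr0 invr1.
Qed.

(** This is k times ln y < y at y = (d/k) x; the scaling goes into b. *)
Lemma ln_le_linear (k d : R) : 0 < k -> 0 < d ->
  exists b : R, forall x, 0 < x -> k * ln x <= d * x + b.
Proof.
move=> k0 d0; exists (- (k * ln (d / k))) => x x0.
have dk0 : 0 < d / k by exact: divr_gt0.
have := ln_sublinear (mulr_gt0 dk0 x0).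
rewrite (lnM dk0 x0) => /ltW; rewrite -(ler_pM2l k0) mulrDr.
have -> : k * (d / k * x) = d * x by field; rewrite gt_eqF.
lra.
Qed.

End Expansion.

Theorem theorem53 (R : realType) (U : machine) (hU : universal U) :
  exists alpha : R, (0 < alpha < 1) /\
    forall (r t : R) (c : nat),
      computable_real r -> computable_real t -> 1 < r -> 1 < t -> (1 <= c)%N ->
      exists b : nat, (1 <= b)%N /\
        forall m : nat, (1 <= m)%N ->
          (H U (first_bits alpha m))%:R >=
            r^-1 * m%:R + c%:R / t * log2 (m%:R : R) - b%:R.
Proof.
have [a incompr] := incompressible_sequence _ (augmented_prefix_code _ (proj1 hU)).
have unending n : exists2 k, (n <= k)%N & a k.
  apply: contrapT => no1; apply: (incompr (n + (n + 4))%N).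
  (* If only zeros occur from n on, the prefix of length 2n + 4 gets this code of length 2n + 3. *)
  exists [:: true, false & nseq n true ++ false :: mkseq a n].
    exists (mkseq a n); rewrite size_mkseq//.
    rewrite /mkseq iotaD map_cat; congr cat.
    apply: (@eq_from_nth _ false) => [|i]; rewrite size_map size_iota ?size_nseq// => lti.
    rewrite (nth_map 0%N) ?size_iota// nth_iota// nth_nseq lti.
    by apply/negP => ai; apply: no1; exists (0 + n + i)%N => //; rewrite add0n leq_addr.
  rewrite /= size_cat /= size_nseq !size_mkseq; lia.
have [i ai] : exists i, a i = false.
  apply: contrapT => no0; apply: (incompr 3%N); exists [:: true; true] => //=.
  have a1 j : a j by apply: contrapT => /negP/negbTE aj; apply: no0; exists j.
  by rewrite /mkseq /= !a1.
pose alpha : R := limn (series (fun i : nat => (a i)%:R / 2 ^+ i.+1 : R)).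
have ha : unending_expansion alpha a by split=> //; exact: partial_cvg.
exists alpha; split; first exact: expansion_in01 ai.
move=> r t c _ _ r1 t1 c1.
have r0 : 0 < r by lra.
have t0 : 0 < t by lra.
have ln2 : 0 < ln 2 :> R by rewrite ln_gt0// ltr1n.
have k0 : 0 < c%:R / t / ln 2 by rewrite !divr_gt0// ltr0n.
have d0 : 0 < 1 - r^-1 by rewrite subr_gt0 invf_lt1.
have [b0 hb0] := ln_le_linear _ _ _ k0 d0.
(* The summand 1 pays for the tag bit 0 put before programs of U. *)
exists (Num.truncn (b0 + 1)).+1; split=> // m m1.
have := truncnS_gt (b0 + 1); move: (Num.truncn _).+1%:R => b hb.
have := hb0 m%:R; rewrite ltr0n => /(_ m1) hm.
have hH : m%:R <= (H U (first_bits alpha m))%:R + 1 :> R.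
  rewrite natr1 ler_nat leqNgt; apply/negP => ltH.
  have [w Uw szw] := H_program _ (first_bits alpha m) hU.
  apply: (incompr m); exists (false :: w); first by rewrite /= -(digitsE _ _ _ ha).
  by rewrite /= szw size_mkseq.
have -> : c%:R / t * log2 (m%:R : R) = c%:R / t / ln 2 * ln m%:R.
  by rewrite /log2 mulrA mulrAC.
lra.
Qed.
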